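(* Let $A$ be a finite non-empty alphabet and let $\lambda,\rho$ be two left-infinite words over $A$. For $n\in\mathbb{N}$ let $\lambda_n$ and $\rho_n$ be the suffixes of length $n$ of $\lambda$ and $\rho$, respectively. Then the set $\{og(\lambda_n,\rho_n):n\in\mathbb{N}\}$ is finite if and only if $\rho=\lambda w$ or $\lambda=\rho w$ for some finite word $w\in A^*$.
   Context: $A^*$ is the set of finite words over $A$ (including the empty word); $\mathbb{N}=\{0,1,2,\dots\}$. A left-infinite word is a sequence $\cdots a_{-2}a_{-1}a_0$ of letters indexed by $-\mathbb{N}$; for a left-infinite word $\lambda$ and $w\in A^*$, $\lambda w$ is the left-infinite word obtained by appending $w$ on the right. For finite words $u,v$ of equal length: $log(u,v)=\min\{n\in\mathbb{N}: ux=x'v \text{ for some } x,x'\in A^n\}$, $rog(u,v)=\min\{n\in\mathbb{N}: xu=vx' \text{ for some } x,x'\in A^n\}$, and $og(u,v)=\min\{log(u,v),rog(u,v)\}$. *)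

(* Defs.v *)
From HB Require Import structures.
From mathcomp Require Import all_boot.
From mathcomp Require Import boolp classical_sets functions cardinality.
Set Implicit Arguments.
Unset Strict Implicit.
Unset Printing Implicit Defensive.

(* A left-infinite word ... a_{-2} a_{-1} a_0 is the map sending i to a_{-i}. *)
Definition lword (A : Type) := nat -> A.

Definition lword_cat (A : Type) (l : lword A) (w : seq A) : lword A :=
  fun i => if i < size w then nth (l 0) (rev w) i else l (i - size w).

(* a_{-(n-1)} ... a_{-1} a_0 *)
Definition lsuffix (A : Type) (l : lword A) (n : nat) : n.-tuple A :=
  [tuple l (rev_ord i) | i < n].

Definition log_pred (A : finType) (m : nat) (u v : m.-tuple A) : pred nat :=
  fun n => [exists x : n.-tuple A, exists x' : n.-tuple A,
              (u ++ x == x' ++ v :> seq A)].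

Definition rog_pred (A : finType) (m : nat) (u v : m.-tuple A) : pred nat :=
  fun n => [exists x : n.-tuple A, exists x' : n.-tuple A,
              (x ++ u == v ++ x' :> seq A)].

Lemma log_pred_ex (A : finType) (m : nat) (u v : m.-tuple A) :
  exists n, log_pred u v n.
Proof. by exists m; apply/existsP; exists v; apply/existsP; exists u. Qed.

Lemma rog_pred_ex (A : finType) (m : nat) (u v : m.-tuple A) :
  exists n, rog_pred u v n.
Proof. by exists m; apply/existsP; exists v; apply/existsP; exists u. Qed.

Definition log (A : finType) (m : nat) (u v : m.-tuple A) : nat :=
  ex_minn (log_pred_ex u v).

Definition rog (A : finType) (m : nat) (u v : m.-tuple A) : nat :=
  ex_minn (rog_pred_ex u v).

Definition og (A : finType) (m : nat) (u v : m.-tuple A) : nat :=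
  minn (log u v) (rog u v).

(* Main.v *)
Require Import Defs.
From HB Require Import structures.
From mathcomp Require Import all_boot.
From mathcomp Require Import boolp classical_sets functions cardinality.
Set Implicit Arguments.
Unset Strict Implicit.
Unset Printing Implicit Defensive.
Local Open Scope classical_set_scope.

(** For fixed [n], the property [log_pred] of the length-[m] suffixes of [lam]
    and [rho] says that [rho (n + j) = lam j] whenever [n + j < m], so it only
    gets stronger as [m] grows. If the overlap gaps are bounded by [B], then for
    every [m] some shift [n <= B], in one of the two directions, works; as there
    are finitely many candidates and the condition is monotone in [m], a single
    shift works for all [m], which means that one word extends the other by [n]
    letters. *)

(** Reversal puts the letter of index [i] at position [i] whatever [n] is, so suffixes of different
    lengths become prefixes of one sequence. *)
Lemma rev_lsuffix (A : Type) (l : lword A) (n : nat) :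
  rev (lsuffix l n) = mkseq l n.
Proof.
apply: (@eq_from_nth _ (l 0)) => [|i]; rewrite size_rev size_tuple.
  by rewrite size_mkseq.
move=> lt_in; rewrite nth_rev size_tuple // nth_mkseq //.
have lt_r : n - i.+1 < n by rewrite ltn_subrL (leq_ltn_trans _ lt_in).
rewrite -[n - i.+1]/(nat_of_ord (Ordinal lt_r)) -tnth_nth tnth_mktuple /=.
by rewrite -subSn // subSS subKn // ltnW.
Qed.

Lemma mkseq_add (A : Type) (f : nat -> A) (m n : nat) :
  mkseq f (m + n) = mkseq f m ++ mkseq (fun i => f (m + i)) n.
Proof.
by rewrite /mkseq iotaD map_cat add0n -[in iota m n](addn0 m) iotaDl -map_comp.
Qed.

Lemma lword_cat_exists (A : Type) (l r : lword A) (n : nat) :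
  (exists2 w : seq A, size w = n & r = lword_cat l w) <->
  forall j, r (n + j) = l j.
Proof.
split=> [[w <- ->] j|rl].
  by rewrite /lword_cat ltnNge leq_addr /= addKn.
exists (lsuffix r n); first by rewrite size_tuple.
apply/funext => i; rewrite /lword_cat size_tuple rev_lsuffix.
by case: ltnP => [lt_in|le_ni]; [rewrite nth_mkseq | rewrite -rl subnKC].
Qed.

(** Both sides are the same word equation, read in opposite directions; hence only [log_pred] needs
    study. *)
Lemma rog_predC (A : finType) (m : nat) (u v : m.-tuple A) :
  rog_pred u v =1 log_pred v u.
Proof.
move=> n; apply/existsP/existsP => -[x /existsP[y /eqP e]];
by exists y; apply/existsP; exists x; rewrite e.
Qed.

Lemma log_pred_lsuffix (A : finType) (l r : lword A) (m n : nat) :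
  log_pred (lsuffix l m) (lsuffix r m) n ->
  forall j, n + j < m -> r (n + j) = l j.
Proof.
move=> /existsP[x /existsP[y /eqP /(congr1 rev)]].
rewrite !rev_cat !rev_lsuffix => e j lt_m.
(* In [rev x ++ mkseq l m = mkseq r m ++ rev y], position [n + j] lies past [rev x] on the left and
   still inside [mkseq r m] on the right. *)
have /= := congr1 (fun s => nth (l 0) s (n + j)) e.
rewrite !nth_cat size_rev size_tuple size_mkseq lt_m ltnNge leq_addr /= addKn.
by rewrite !nth_mkseq // (leq_ltn_trans (leq_addl n j)).
Qed.

Lemma shift_log_pred (A : finType) (l r : lword A) (n : nat) :
  (forall j, r (n + j) = l j) ->
  forall m, log_pred (lsuffix l m) (lsuffix r m) n.
Proof.
(* The paddings are the last [n] letters of [r] and the [n] letters just before its suffix of length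
   [m]: both sides then spell the suffix of [r] of length [m + n]. *)
move=> rl m; apply/existsP; exists (lsuffix r n); apply/existsP.
exists (lsuffix (fun i => r (m + i)) n).
apply/eqP/(can_inj revK); rewrite !rev_cat !rev_lsuffix -mkseq_add addnC.
by rewrite mkseq_add; congr (_ ++ _); apply: eq_mkseq => j; rewrite rl.
Qed.

Lemma og_witness (A : finType) (m : nat) (u v : m.-tuple A) :
  log_pred u v (og u v) \/ log_pred v u (og u v).
Proof.
rewrite /og /log /rog; case: ex_minnP => a la _; case: ex_minnP => b.
by rewrite rog_predC => lb _; case: leqP => _; [left | right].
Qed.

Lemma og_le (A : finType) (m : nat) (u v : m.-tuple A) (n : nat) :
  log_pred u v n \/ log_pred v u n -> og u v <= n.
Proof.
rewrite /og /log /rog geq_min; case: ex_minnP => a _ mina.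
case: ex_minnP => b _ minb [/mina ->//|]; rewrite -rog_predC => /minb ->.
by rewrite orbT.
Qed.

Lemma antitone_pigeonhole (P : nat -> nat -> Prop) (B : nat) :
  (forall n m m', m <= m' -> P n m' -> P n m) ->
  (forall m, exists2 n, n <= B & P n m) ->
  exists n, forall m, P n m.
Proof.
move=> anti exP; apply: contrapT => /forallNP nP.
have /choice[f nPf] : forall n, exists m, ~ P n m by move=> n; apply/existsNP.
(* If every [n <= B] failed at some [f n], all of them would fail at the maximum of these values. *)
have [n le_nB] := exP (\max_(i < B.+1) f i).
by move/(anti _ (f n)) => Pf; apply/(nPf n)/Pf/(leq_bigmax (Ordinal (le_nB : n < B.+1))).
Qed.

Theorem theorem4p1 (A : finType) (hA : 0 < #|A|) (lam rho : lword A) :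
  finite_set [set og (lsuffix lam n) (lsuffix rho n) | n in [set: nat]] <->
  exists w : seq A, rho = lword_cat lam w \/ lam = lword_cat rho w.
Proof.
pose shift (l r : lword A) n m := forall j, n + j < m -> r (n + j) = l j.
have shift_anti l r n m m' : m <= m' -> shift l r n m' -> shift l r n m.
  by move=> le_m s j lt_m; apply/s/(leq_trans lt_m).
have shift_all l r n : (forall m, shift l r n m) -> forall j, r (n + j) = l j.
  by move=> s j; apply: (s (n + j).+1).
split=> [/finite_seqP[s es]|[w ew]].
  have [|m|n s_n] := @antitone_pigeonhole
      (fun n m => shift lam rho n m \/ shift rho lam n m) (\max_(i <- s) i).
  - by move=> n m m' le_m [] /(shift_anti _ _ _ _ _ le_m); [left | right].
  - exists (og (lsuffix lam m) (lsuffix rho m)).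
      apply: leq_bigmax_seq => //.
      have : [set` s] (og (lsuffix lam m) (lsuffix rho m)).
        by rewrite -es; exists m.
      by [].
    by have [/log_pred_lsuffix|/log_pred_lsuffix] :=
      og_witness (lsuffix lam m) (lsuffix rho m); [left | right].
  have [s1|/existsNP[m1 ns1]] := pselect (forall m, shift lam rho n m).
    have /lword_cat_exists[w _ ->] := shift_all _ _ _ s1.
    by exists w; left.
  suff /shift_all/lword_cat_exists[w _ ->] : forall m, shift rho lam n m.
    by exists w; right.
  (* The direction may still depend on the length. Since the first one fails at [m1], it fails at
     [maxn m1 m], where the second must hold. *)
  move=> m; have [/(shift_anti _ _ _ _ _ (leq_maxl m1 m))//|] := s_n (maxn m1 m).
  exact/shift_anti/leq_maxr.
(* A shift by [size w] works at every length, so it bounds all the gaps. *)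
apply: (sub_finite_set _ (finite_II (size w).+1)) => _ [m _ <-] /=.
rewrite ltnS; apply: og_le.
by case: ew => e; [left | right]; apply: shift_log_pred;
  apply/lword_cat_exists; exists w.
Qed.
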